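(* Let $f:\mathbb{R}^n\to\mathbb{R}$ be $\mu$-strongly convex and let $g:\mathbb{R}^n\to\mathbb{R}^{n_{\rm g}}$ be smooth and concave. Let $l(x)=f(x)-{\lambda^*}^{T}g(x)$ denote the Lagrangian, where $\lambda^*$ denotes an optimal multiplier of the problem $\min_{x\in\mathbb{R}^n}f(x)$ s.t. $g(x)\ge0$, whose minimizer is $x^*$. Let $L_l$ denote the smoothness constant of $l$ and $\kappa_l=L_l/\mu$. Then the iterates, starting from $x_0\in\mathbb{R}^n$ and $u_0=0$, of $$y_k=x_k+\beta u_k,$$ $$u_{k+1}=\operatorname*{argmin}_{v\in\mathbb{R}^n}\tfrac12\big|v-u_k+2\delta T_ku_k+\nabla f(y_k)T_k\big|^2$$ $$\text{s.t.}\quad \nabla g_i(y_k)^{T}v\ \ge\ -\alpha g_i(x_k)-\frac{g_i(y_k)-g_i(x_k)-\nabla g_i(y_k)^{T}\beta u_k}{T_k},\quad i\in\{1,\dots,n_{\rm g}\},$$ $$x_{k+1}=x_k+T_ku_{k+1},$$ with $T_k=1/\sqrt{L_l}$, $\delta=\sqrt{L_l}/(\sqrt{\kappa_l}+1)$, $\beta=T_k(1-2\delta T_k)$ and $\alpha=\delta$, satisfy $$\frac{\mu}{2}|x_k-x^*|^2\ \le\ l(x_k)-l(x^* )\ \le\ \Big(1-\frac{1}{1+\sqrt{\kappa_l}}\Big)^k\Big(\frac{L_l}{8}|x_0-x^*|^2+l(x_0)-l(x^* )\Big)\qquad\text{for all }k\ge 0.$$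
   Context: Smooth means differentiable with Lipschitz gradient; the smoothness constant of $l$ is a Lipschitz constant $L_l$ of $\nabla l$. Concavity of $g$ is componentwise. $f$ is continuously differentiable and coercive, and $C=\{x: g(x)\ge 0\}$ is compact (and nonempty). Optimal multiplier: $\lambda^*\in\mathbb{R}^{n_{\rm g}}$ with $\lambda^*\ge 0$, $\nabla f(x^* )=\sum_i\nabla g_i(x^* )\lambda^*_i$, and $\lambda^*_ig_i(x^* )=0$ for all $i$ (Karush-Kuhn-Tucker conditions). $|\cdot|$ is the Euclidean norm. *)

(* Defs.v *)
From HB Require Import structures.
From mathcomp Require Import all_boot all_order all_algebra.
From mathcomp Require Import all_classical all_reals all_analysis.

Set Implicit Arguments.
Unset Strict Implicit.
Unset Printing Implicit Defensive.

Import Order.TTheory GRing.Theory Num.Theory.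
Import numFieldNormedType.Exports.

Local Open Scope classical_set_scope.
Local Open Scope ring_scope.
Local Open Scope convex_scope.

(* Points of R^n are row vectors.  The library norm [`|x|] on ['rV[R]_n] is the
   sup norm; it induces the usual topology and the usual notion of
   differentiability, but Lipschitz constants, strong convexity and projections
   depend on the norm, hence the Euclidean norm [enorm] below. *)
Section Euclidean.
Context {R : realType} {n : nat}.
Implicit Types (u v x : 'rV[R]_n) (h : 'rV[R]_n -> R).

Definition dot u v : R := \sum_(i < n) u 0 i * v 0 i.

Definition enorm v : R := Num.sqrt (dot v v).

Definition grad h x : 'rV[R]_n := \row_(i < n) 'D_(delta_mx 0 i) h x.

Definition differentiable_everywhere h := forall x, differentiable h x.

Definition continuously_differentiable h :=
  differentiable_everywhere h /\ continuous (grad h).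

Definition smooth_with (L : R) h :=
  differentiable_everywhere h /\
  forall x y, enorm (grad h x - grad h y) <= L * enorm (x - y).

Definition smooth h := exists L : R, smooth_with L h.

Definition concave h := convex_function [set: 'rV[R]_n] (fun x => - h x).

(* [x <| t |> y] is [t *: x + (1 - t) *: y]. *)
Definition strongly_convex (mu : R) h :=
  0 < mu /\
  forall (t : {i01 R}) (x y : convex_lmodType 'rV[R]_n),
    h (x <| t |> y) <= t%:num * h x + (1 - t%:num) * h y
                       - mu / 2 * (t%:num * (1 - t%:num)) * enorm (x - y) ^+ 2.

Definition coercive h :=
  forall M : R, exists r : R, forall x, r < enorm x -> M < h x.

Definition is_argmin (D : set 'rV[R]_n) h v :=
  D v /\ forall w, D w -> h v <= h w.

End Euclidean.

Section ConstrainedProblem.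
Context {R : realType} {n ng : nat}.
Variables (f : 'rV[R]_n -> R) (g : 'rV[R]_n -> 'rV[R]_ng).

Definition component (i : 'I_ng) : 'rV[R]_n -> R := fun x => g x 0 i.

Definition feasible : set 'rV[R]_n := [set x | forall i, 0 <= component i x].

Definition lagrangian (lambda : 'rV[R]_ng) (x : 'rV[R]_n) : R :=
  f x - dot lambda (g x).

Definition optimal_multiplier (xstar : 'rV[R]_n) (lambda : 'rV[R]_ng) :=
  [/\ forall i, 0 <= lambda 0 i,
      grad f xstar = \sum_(i < ng) lambda 0 i *: grad (component i) xstar
    & forall i, lambda 0 i * component i xstar = 0].

Section Algorithm.
Variables (T alpha beta delta : R).

Definition velocity_objective (y u v : 'rV[R]_n) : R :=
  1 / 2 * enorm (v - u + (2 * delta * T) *: u + T *: grad f y) ^+ 2.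

Definition velocity_set (x y u : 'rV[R]_n) : set 'rV[R]_n :=
  [set v | forall i : 'I_ng,
    let gi := component i in
    dot (grad gi y) v >=
      - alpha * gi x - (gi y - gi x - dot (grad gi y) (beta *: u)) / T].

Definition iterates (x u : nat -> 'rV[R]_n) :=
  forall k : nat,
    let y := x k + beta *: u k in
    is_argmin (velocity_set (x k) y (u k)) (velocity_objective y (u k))
      (u k.+1) /\
    x k.+1 = x k + T *: u k.+1.

End Algorithm.
End ConstrainedProblem.

(* Main.v *)
Require Import Defs.
From HB Require Import structures.
From mathcomp Require Import all_boot all_order all_algebra.
From mathcomp Require Import all_classical all_reals all_analysis.
From mathcomp Require Import ring lra.
Import Order.TTheory GRing.Theory Num.Theory.
Import numFieldNormedType.Exports.
Local Open Scope classical_set_scope.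
Local Open Scope ring_scope.

(** The velocity constraint, multiplied by [T] and rewritten in terms of the
    position [x' = x + T v], says that the linearisation of each [g_i] at [y]
    is at least [(1 - rho) g_i(x)] at [x'], where [rho = alpha T = 1 / (1 + s)]
    and [s = sqrt kappa] ([velocity_setP]).  As [T ^ 2 = 1 / Ll], the step is
    therefore a projected gradient step for [f] alone: [x'] is the projection
    of [y - grad f(y) / Ll] onto a polyhedron that depends on [x] and [y].

    Two facts link this step on [f] to the Lagrangian [l = f - lambda g].
    The descent lemma for [l] at [y] ([descent_lemma]) bounds [l x'] by a
    quadratic model whose [g]-part is [- lambda] times the linearised
    constraints at [x'], hence at most [- (1 - rho) lambda g(x)]: the gradient
    of [l], which the algorithm never sees, has been traded for that of [f].
    On the other hand, concavity of [g] puts the point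
    [w = (1 - rho) x + rho xstar] into the polyhedron, so that [x'] may be
    compared with [w] by the variational inequality of the projection
    ([argmin_variational], [projection_three_point]).  Strong convexity of [f]
    bounds the linearisation of [f] at [w], a convex combination of its values at
    [x] and [xstar].  What is left is an inequality between squared distances,
    that is, a quadratic form in [x - xstar] and the last displacement, which
    is nonnegative when [s >= 1] ([momentum_quadratic_form]).

    The outcome is that Nesterov's energy
    [l x - l xstar + Ll rho ^ 2 / 2 |x - xstar + s p| ^ 2], with [p] the last
    displacement, shrinks by the factor [1 - rho] at each step ([energy_step]).
    Initially [p = 0], and [rho <= 1 / 2] gives the constant [Ll / 8].  The
    lower bound holds because [l] is strongly convex and [xstar] is stationary
    for it ([lagrangian_minimizer_growth]). *)

(** * Euclidean inner product *)

Section EuclideanAlgebra.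
Context {R : realType} {n : nat}.
Implicit Types (a : R) (u v w : 'rV[R]_n).

Lemma dotC u v : dot u v = dot v u.
Proof. by apply: eq_bigr => i _; rewrite mulrC. Qed.

Lemma dotDl u v w : dot (u + v) w = dot u w + dot v w.
Proof. by rewrite /dot -big_split; apply: eq_bigr => i _; rewrite mxE mulrDl. Qed.

Lemma dotZl a u v : dot (a *: u) v = a * dot u v.
Proof. by rewrite /dot mulr_sumr; apply: eq_bigr => i _; rewrite mxE mulrA. Qed.

Lemma dotDr u v w : dot w (u + v) = dot w u + dot w v.
Proof. by rewrite !(dotC w) dotDl. Qed.

Lemma dotZr a u v : dot v (a *: u) = a * dot v u.
Proof. by rewrite !(dotC v) dotZl. Qed.

Lemma dotNl u v : dot (- u) v = - dot u v.
Proof. by rewrite -scaleN1r dotZl mulN1r. Qed.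

Lemma dotNr u v : dot v (- u) = - dot v u.
Proof. by rewrite -scaleN1r dotZr mulN1r. Qed.

Lemma dot0l v : dot 0 v = 0.
Proof. by rewrite -(scale0r 0) dotZl mul0r. Qed.

Definition dotE := (dotDl, dotDr, dotNl, dotNr, dotZl, dotZr).

Lemma dot_sqr_add a u v :
  dot (u + a *: v) (u + a *: v) = dot u u + 2 * a * dot u v + a ^+ 2 * dot v v.
Proof. by rewrite !dotE (dotC v u); ring. Qed.

Lemma dot_suml (I : finType) (F : I -> 'rV[R]_n) v :
  dot (\sum_i F i) v = \sum_i dot (F i) v.
Proof. by apply: (big_morph (dot^~ v)) => [a b|]; rewrite ?dotDl ?dot0l. Qed.

Lemma dot_ge0 v : 0 <= dot v v.
Proof. by apply: sumr_ge0 => i _; rewrite -expr2 sqr_ge0. Qed.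

Lemma dot_eq0 v : dot v v = 0 -> v = 0.
Proof.
move=> /eqP; rewrite psumr_eq0 => [/allP v0|i _]; last by rewrite -expr2 sqr_ge0.
apply/rowP => i; rewrite mxE; have /= := v0 i (mem_index_enum i).
by rewrite mulf_eq0 orbb => /eqP.
Qed.

Lemma enorm_ge0 v : 0 <= enorm v.
Proof. exact: sqrtr_ge0. Qed.

Lemma sqr_enorm v : enorm v ^+ 2 = dot v v.
Proof. by rewrite sqr_sqrtr // dot_ge0. Qed.

Lemma enormZ a v : 0 <= a -> enorm (a *: v) = a * enorm v.
Proof.
move=> a0; rewrite /enorm !dotE mulrA -expr2 sqrtrM ?sqr_ge0//.
by rewrite sqrtr_sqr ger0_norm.
Qed.

Lemma Cauchy_Schwarz u v : dot u v <= enorm u * enorm v.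
Proof.
have [/dot_eq0 ->|u0] := eqVneq (dot u u) 0.
  by rewrite dot0l mulr_ge0 ?enorm_ge0.
have [/dot_eq0 ->|v0] := eqVneq (dot v v) 0.
  by rewrite dotC dot0l mulr_ge0 ?enorm_ge0.
have u_gt0 : 0 < enorm u by rewrite sqrtr_gt0 lt_neqAle eq_sym u0 dot_ge0.
have v_gt0 : 0 < enorm v by rewrite sqrtr_gt0 lt_neqAle eq_sym v0 dot_ge0.
have := dot_ge0 (enorm v *: u - enorm u *: v).
rewrite !dotE (dotC v u) -!sqr_enorm => h.
have uv_gt0 : 0 < enorm u * enorm v by rewrite mulr_gt0.
rewrite -(ler_pM2l uv_gt0); lra.
Qed.

End EuclideanAlgebra.

(** * Projection onto a convex set *)

Section Projection.
Context {R : realType} {n : nat}.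
Implicit Types (a c v w : 'rV[R]_n).

(** Moving from the projection [v] of [c] towards another point [w] of the set
    cannot decrease the distance to [c].  The segment hypothesis is the
    convexity of [D] between [v] and [w]. *)
Lemma argmin_variational (D : set 'rV[R]_n) c v w :
  is_argmin D (fun a => 1 / 2 * enorm (a - c) ^+ 2) v ->
  (forall t : R, 0 < t < 1 -> D (v + t *: (w - v))) ->
  0 <= dot (v - c) (w - v).
Proof.
move=> [_ v_min] seg; set d := w - v; set p := v - c.
rewrite leNgt; apply/negP => a_lt0.
set a := dot p d in a_lt0; set b := dot d d.
have b_ge0 : 0 <= b by exact: dot_ge0.
(* A step short enough for the linear term of |v + t d - c|^2 to beat the
   quadratic one. *)
set t := - a / (b - a + 1).
have den_gt0 : 0 < b - a + 1 by lra.
have t_gt0 : 0 < t by rewrite divr_gt0 // oppr_gt0.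
have t_lt1 : t < 1 by rewrite ltr_pdivrMr //; lra.
have at_eq : t * (b - a + 1) = - a by rewrite divfK ?gt_eqF.
have := v_min _ (seg t _); rewrite t_gt0 t_lt1 => /(_ isT).
rewrite !sqr_enorm (_ : v + _ - c = p + t *: d); last by rewrite addrAC.
rewrite dot_sqr_add -/a -/b => h; have {h} : 0 <= t * (2 * a + t * b) by lra.
rewrite pmulr_rge0 //.
have : 0 < t * (1 - a) by rewrite mulr_gt0 //; lra.
have -> : t * b = - a - t * (1 - a) by lra.
lra.
Qed.

End Projection.

(** * First-order bounds from smoothness and convexity *)

Section Gradient.
Context {R : realType} {n : nat}.
Implicit Types (h : 'rV[R]_n -> R) (x y d : 'rV[R]_n).

Lemma derive_grad h x d : differentiable h x -> 'D_d h x = dot (grad h x) d.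
Proof.
move=> dh; rewrite deriveE // [in LHS](row_sum_delta d) linear_sum /=.
by apply: eq_bigr => i _; rewrite linearZ /= mxE -deriveE // mulrC.
Qed.

Lemma is_derive_line h x d (t : R) : differentiable h (x + t *: d) ->
  is_derive t 1 (fun s : R => h (x + s *: d)) (dot (grad h (x + t *: d)) d).
Proof.
move=> dh.
(* The difference quotients of both derivatives are the same function. *)
have quotE :
  (fun s : R => s^-1 *: (((fun s : R => h (x + s *: d)) \o shift t) (s *: 1)
                         - h (x + t *: d))) =
  (fun s : R => s^-1 *: ((h \o shift (x + t *: d)) (s *: d)
                         - h (x + t *: d))).
  apply/funext => s /=; congr (_ *: (h _ - _)).
  by rewrite [s *: 1]mulr1 scalerDl addrC addrA addrAC -addrA.
have dhd := @diff_derivable _ _ _ h _ d dh.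
split; first by rewrite /derivable quotE.
by rewrite -derive_grad // /derive quotE.
Qed.

(** Along the segment from [x] to [y], [h] minus its quadratic model has
    derivative at most [0] by the Lipschitz bound on the gradient; the mean
    value theorem concludes. *)
Lemma descent_lemma L h x y : smooth_with L h ->
  h y <= h x + dot (grad h x) (y - x) + L / 2 * enorm (y - x) ^+ 2.
Proof.
move=> [dh lip]; set d := y - x.
set D := dot (grad h x) d; set N := enorm d ^+ 2.
pose phi : R -> R :=
  (fun t => h (x + t *: d)) - D *: id - (L / 2 * N) *: (id ^+ 2).
pose dphi (t : R) := dot (grad h (x + t *: d)) d - D - L * N * t.
have dphiP (t : R) : is_derive t 1 phi (dphi t).
  have dline := is_derive_line _ _ _ _ (dh (x + t *: d)).
  apply: is_derive_eq.
  by rewrite /dphi /GRing.scale /=; field.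
have [|c c01] := @MVT_segment R phi dphi 0 1 ler01 (fun t _ => dphiP t).
  apply: continuous_subspaceT => t; apply: differentiable_continuous.
  exact/derivable1_diffP/(ex_derive (is_derive := dphiP t)).
have -> : phi 0 = h x.
  by rewrite /phi /= !fctE /= scale0r addr0 !scaler0 expr0n /= scaler0 !subr0.
have -> : phi 1 = h y - D - L / 2 * N.
  by rewrite /phi /= !fctE /= scale1r subrKC expr1n /GRing.scale /= !mulr1.
rewrite subr0 mulr1 => phiE.
suff : dphi c <= 0 by rewrite -phiE; lra.
have [c_ge0 _] : 0 <= c /\ c <= 1 by move: c01; rewrite in_itv /= => /andP.
rewrite /dphi -dotNl -dotDl subr_le0.
apply: le_trans (Cauchy_Schwarz _ _) _.
have := lip (x + c *: d) x; rewrite [_ - x]addrAC subrr add0r enormZ //.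
move=> /(ler_wpM2r (enorm_ge0 d)) /le_trans; apply.
by rewrite /N expr2 le_eqVlt; apply/orP; left; apply/eqP; ring.
Qed.

(** Common source of the tangent inequalities below: dividing the hypothesis by
    [t] and letting [t] tend to [0] from the right leaves [c - m].  The case
    [m = 0] is plain convexity. *)
Lemma grad_le_chord h x d (c m : R) : differentiable h x ->
  (forall t : R, 0 < t < 1 ->
    h (x + t *: d) <= h x + t * c - m * (t * (1 - t))) ->
  dot (grad h x) d <= c - m.
Proof.
move=> dh chord; rewrite -derive_grad //.
have dhd := @diff_derivable _ _ _ h _ d dh.
have /cvg_dnbhs_at_right quot_cvg :
    (fun t : R => t^-1 *: ((h \o shift x) (t *: d) - h x)) @ 0^' --> 'D_d h x.
  exact: dhd.
apply: (ler_cvg_to quot_cvg (g := fun t : R => c - m + m * t)).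
  rewrite [X in _ --> X](_ : _ = c - m + m * 0); last by rewrite mulr0 addr0.
  apply: cvgD; first exact: cvg_cst.
  apply: cvgM; first exact: cvg_cst.
  by apply: cvg_at_right_filter; exact: cvg_id.
near=> t.
have t01 : 0 < t < 1.
  apply/andP; split; near: t; [exact: nbhs_right_gt | exact: nbhs_right_lt].
have t_gt0 : 0 < t by case/andP: t01.
rewrite [_ *: _]mulrC ler_pdivrMr //= [t *: d + x]addrC; have := chord t t01; lra.
Unshelve. all: by end_near.
Qed.

Lemma convE_segment (t : {i01 R}) (x y : convex_lmodType 'rV[R]_n) :
  conv t y x = x + t%:num *: (y - x).
Proof.
by rewrite /conv /= /unstable.onem scalerBl scale1r scalerBr addrC addrAC -addrA.
Qed.

Lemma strongly_convex_above_tangent mu h x y : differentiable h x ->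
  strongly_convex mu h ->
  h x + dot (grad h x) (y - x) + mu / 2 * enorm (y - x) ^+ 2 <= h y.
Proof.
move=> dh [_ sc]; rewrite addrAC -lerBrDl.
rewrite (_ : _ - _ = h y - h x - mu / 2 * enorm (y - x) ^+ 2); last by ring.
apply: grad_le_chord => // t /andP[t_gt0 t_lt1].
by have := sc (Itv01 (ltW t_gt0) (ltW t_lt1)) y x; rewrite convE_segment /=; lra.
Qed.

Lemma concave_below_tangent h x y : differentiable h x -> concave h ->
  h y <= h x + dot (grad h x) (y - x).
Proof.
move=> dh cc.
have : dot (grad (fun z => - h z) x) (y - x) <= - h y + h x - 0.
  apply: grad_le_chord => [|t /andP[t_gt0 t_lt1]]; first exact: differentiableN.
  have := cc (Itv01 (ltW t_gt0) (ltW t_lt1)) y x (mem_set I) (mem_set I).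
  by rewrite convE_segment convRE /= /unstable.onem; lra.
rewrite -!derive_grad //; last exact: differentiableN.
rewrite deriveN; last exact: diff_derivable.
lra.
Qed.

End Gradient.

(** * The Lagrangian *)

Section Lagrangian.
Context {R : realType} {n ng : nat}.
Context (f : 'rV[R]_n -> R) (g : 'rV[R]_n -> 'rV[R]_ng) (lambda : 'rV[R]_ng).

Lemma dot_grad_lagrangian x d : differentiable f x ->
  (forall i, differentiable (component g i) x) ->
  dot (grad (lagrangian f g lambda) x) d =
  dot (grad f x) d - \sum_i lambda 0 i * dot (grad (component g i) x) d.
Proof.
move=> df dg.
have lE : lagrangian f g lambda = f - \sum_i (lambda 0 i *: component g i).
  by apply/funext => z; rewrite /lagrangian !fctE fct_sumE.
have dlg i : derivable (lambda 0 i *: component g i) x d.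
  by apply: derivableZ; exact: diff_derivable.
rewrite -!derive_grad //; last first.
  rewrite lE; apply: differentiableB => //; apply: differentiable_sum => i.
  exact: differentiableZ.
rewrite lE deriveB; [|exact: diff_derivable|exact: derivable_sum].
rewrite derive_sum //; congr (_ - _); apply: eq_bigr => i _.
by rewrite deriveZ ?derive_grad //; exact: diff_derivable.
Qed.

End Lagrangian.

(** * Inequalities behind the energy decrease *)

Section Energy.
Context {R : realType} {n : nat}.
Implicit Types (e p q G : 'rV[R]_n).

(** With [a], [2 b], [c] the coefficients, [a] times the form is
    [|a e + b p| ^ 2 + (a c - b ^ 2) |p| ^ 2], and
    [a c - b ^ 2 = s ^ 4 + 2 s ^ 3 (s ^ 2 - 1) + s]. *)
Lemma momentum_quadratic_form (s : R) e p : 1 <= s ->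
  0 <= (2 * s + 1) * dot e e + 2 * (2 * s ^+ 2 - 1) * dot e p
       + (s ^+ 4 + 2 * s ^+ 3 - 2 * s ^+ 2 - s + 1) * dot p p.
Proof.
move=> s1.
have a_gt0 : 0 < 2 * s + 1 by lra.
have disc : 0 <= s ^+ 4 + 2 * s ^+ 3 * (s ^+ 2 - 1) + s.
  by rewrite !addr_ge0 ?mulr_ge0 ?exprn_ge0 ?subr_ge0 ?exprn_ege1 //; lra.
rewrite -(pmulr_rge0 _ a_gt0).
have := addr_ge0 (dot_ge0 ((2 * s + 1) *: e + (2 * s ^+ 2 - 1) *: p))
  (mulr_ge0 disc (dot_ge0 p)).
rewrite !dotE (dotC p e) => /le_trans; apply.
by rewrite le_eqVlt; apply/orP; left; apply/eqP; ring.
Qed.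

(** Here [e = x - xstar], [b p = y - x] and [mu s ^ 2] is the smoothness
    constant.  The difference of the two sides is [mu rho ^ 3 / 2] times the
    form of [momentum_quadratic_form]. *)
Lemma momentum_distance_contraction (mu s rho b : R) e p :
  0 <= mu -> 1 <= s -> rho = 1 / (1 + s) -> b = 1 - 2 * rho ->
  mu * s ^+ 2 / 2 * dot (rho *: e + b *: p) (rho *: e + b *: p)
    - rho * (mu / 2 * dot (e + b *: p) (e + b *: p))
    - (1 - rho) * (mu / 2 * (b ^+ 2 * dot p p))
  <= (1 - rho) * (mu * s ^+ 2 / 2 * rho ^+ 2 * dot (e + s *: p) (e + s *: p)).
Proof.
move=> mu0 s1 rhoE bE.
have s1_gt0 : 0 < 1 + s by lra.
have c_ge0 : 0 <= mu / 2 * rho ^+ 3.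
  by rewrite rhoE mulr_ge0 ?divr_ge0 ?exprn_ge0 ?divr_ge0 // ltW.
rewrite -subr_ge0.
apply: le_trans (mulr_ge0 c_ge0 (momentum_quadratic_form _ e p s1)) _.
rewrite !dotE (dotC p e) le_eqVlt; apply/orP; left; apply/eqP; rewrite bE rhoE.
by field; rewrite gt_eqF.
Qed.

(** With [q = x' - x] and [b p = y - x], the two vectors of the inner product
    are [L (x' - (y - G / L))] and [w - x'], where
    [w = (1 - rho) x + rho xstar].  So the hypothesis is the variational
    inequality of the projection, and the conclusion is the usual three-point
    estimate for the model [<G, . - y> + L / 2 |. - y| ^ 2] at [x'] and [w]. *)
Lemma projection_three_point (L rho b : R) e p q G :
  0 <= dot (L *: (q - b *: p) + G) (- rho *: e - q) ->
  dot G (q - b *: p) + L / 2 * enorm (q - b *: p) ^+ 2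
    + L / 2 * enorm (rho *: e + q) ^+ 2
  <= L / 2 * dot (rho *: e + b *: p) (rho *: e + b *: p)
     - rho * dot G e - b * dot G p.
Proof.
rewrite !sqr_enorm !dotE (dotC q e) (dotC p e) (dotC q p); lra.
Qed.

End Energy.

(** * One step of the algorithm *)

Section Step.
Context {R : realType} {n ng : nat}.
Context (f : 'rV[R]_n -> R) (g : 'rV[R]_n -> 'rV[R]_ng).
Context (mu Ll : R) (xstar : 'rV[R]_n) (lambda : 'rV[R]_ng).
Let l := lagrangian f g lambda.

Context (df : differentiable_everywhere f) (f_sc : strongly_convex mu f).
Context (dg : forall i, differentiable_everywhere (component g i)).
Context (g_concave : forall i, concave (component g i)).
Context (xstar_feasible : feasible g xstar).
Context (lambda_opt : optimal_multiplier f g xstar lambda).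
Context (l_smooth : smooth_with Ll l).

Lemma lagrangian_above_tangent x y :
  l x + dot (grad l x) (y - x) + mu / 2 * enorm (y - x) ^+ 2 <= l y.
Proof.
have [lambda_ge0 _ _] := lambda_opt.
rewrite /l dot_grad_lagrangian //; last by move=> i; exact: dg.
have fxy := strongly_convex_above_tangent mu f x y (df x) f_sc.
rewrite /lagrangian.
have : dot lambda (g y) <= dot lambda (g x)
    + \sum_i lambda 0 i * dot (grad (component g i) x) (y - x).
  rewrite /dot -big_split /=; apply: ler_sum => i _; rewrite -mulrDr.
  rewrite ler_wpM2l //.
  by apply: concave_below_tangent; [exact: dg|exact: g_concave].
lra.
Qed.

Lemma lagrangian_minimizer_growth x :
  mu / 2 * enorm (x - xstar) ^+ 2 <= l x - l xstar.
Proof.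
have [_ stationary _] := lambda_opt.
have := lagrangian_above_tangent xstar x.
rewrite /l dot_grad_lagrangian //; last by move=> i; exact: dg.
rewrite stationary dot_suml.
under eq_bigr do rewrite dotZl.
by rewrite subrr addr0; lra.
Qed.

(** Both constants bound [l] around its tangent at [0], from either side, at a
    nonzero point; in dimension [0] there is no such point. *)
Lemma smoothness_ge_strong_convexity : (0 < n)%N -> mu <= Ll.
Proof.
move=> n_gt0; pose d : 'rV[R]_n := const_mx 1.
have d_gt0 : 0 < enorm d ^+ 2.
  rewrite lt_neqAle sqr_ge0 andbT eq_sym sqr_enorm.
  apply/eqP => /dot_eq0 /rowP /(_ (Ordinal n_gt0)); rewrite !mxE.
  by apply/eqP; rewrite oner_eq0.
have := descent_lemma _ _ 0 d l_smooth; have := lagrangian_above_tangent 0 d.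
rewrite subr0 => h1 h2.
rewrite -(ler_pM2r d_gt0); lra.
Qed.

Context (s T rho delta beta : R).
Context (s_ge1 : 1 <= s) (T_gt0 : 0 < T).
Context (Ll_mu : Ll = mu * s ^+ 2) (T_Ll : T ^+ 2 * Ll = 1).
Context (rhoE : rho = 1 / (1 + s)) (deltaT : delta * T = rho).
Context (betaE : beta = T * (1 - 2 * rho)).

(** Nesterov's Lyapunov function: since [1 / rho = 1 + s], the point
    [x + s *: p] is [x_prev + (x - x_prev) / rho], the extrapolated sequence of
    the accelerated gradient method, when [p = x - x_prev]. *)
Definition energy (x p : 'rV[R]_n) : R :=
  l x - l xstar + Ll * rho ^+ 2 / 2 * enorm (x - xstar + s *: p) ^+ 2.

Let rho_ge0 : 0 <= rho.
Proof. by rewrite rhoE divr_ge0 //; move: s_ge1; lra. Qed.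

Let rho_le1 : rho <= 1.
Proof. by rewrite rhoE ler_pdivrMr; move: s_ge1; lra. Qed.

(** In terms of positions, feasibility is an affine bound on the new iterate;
    [alpha T = rho] produces the factor [1 - rho]. *)
Lemma velocity_setP x u v : let y := x + beta *: u in
  velocity_set g T delta beta x y u v <->
  forall i, (1 - rho) * component g i x <=
    component g i y + dot (grad (component g i) y) (x + T *: v - y).
Proof.
move=> y; have yE (w : 'rV_n) : x + T *: w - y = T *: w - beta *: u.
  by rewrite /y opprD addrA [_ - x]addrAC subrr add0r.
have T0 : T != 0 by rewrite gt_eqF.
rewrite yE; split => h i; have := h i; rewrite /= !dotE.
  rewrite -(ler_pM2l T_gt0) mulrBr [_ / T]mulrC (mulVKf T0).
  have -> : T * (- delta * component g i x) = - (rho * component g i x).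
    by rewrite -deltaT; ring.
  lra.
move=> {}h; rewrite -(ler_pM2l T_gt0) mulrBr [_ / T]mulrC (mulVKf T0).
have -> : T * (- delta * component g i x) = - (rho * component g i x).
  by rewrite -deltaT; ring.
lra.
Qed.

(** The descent lemma for [l], the comparison of [x + T v] with
    [(1 - rho) x + rho xstar], and the tangent bounds of [f] at [y] towards [x]
    and [xstar] with weights [1 - rho] and [rho] add up to the claim, leaving
    [momentum_distance_contraction] for the squared distances. *)
Lemma energy_step x u v : let y := x + beta *: u in
  is_argmin (velocity_set g T delta beta x y u)
    (velocity_objective f T delta y u) v ->
  energy (x + T *: v) (T *: v) <= (1 - rho) * energy x (T *: u).
Proof.
move=> y vmin.
have [lambda_ge0 _ slack] := lambda_opt.
have [vD _] := vmin.
set e := x - xstar; set p := T *: u; set q := T *: v; set b := 1 - 2 * rho.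
have bp : beta *: u = b *: p by rewrite betaE mulrC -scalerA.
have yE : y = x + b *: p by rewrite /y bp.
have [mu_gt0 _] := f_sc.
(* The comparison velocity: it leads from x to (1 - rho) x + rho xstar. *)
pose w : 'rV[R]_n := - delta *: e.
have wT : T *: w = - rho *: e by rewrite /w scalerA mulrN mulrC deltaT.
have wE : x + T *: w = (1 - rho) *: x + rho *: xstar.
  by rewrite wT scaleNr scalerBr scalerBl scale1r opprB addrA addrAC.
have wD : velocity_set g T delta beta x y u w.
  apply/velocity_setP => i.
  apply: le_trans (concave_below_tangent _ _ _ (dg i _) (g_concave i)).
  have := g_concave i (Itv01 rho_ge0 rho_le1) xstar x (mem_set I) (mem_set I).
  rewrite [conv _ _ _](_ : _ = x + T *: w) /=; last first.
    by rewrite wE /conv /= /unstable.onem addrC.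
  rewrite convRE /= /unstable.onem.
  have := mulr_ge0 rho_ge0 (xstar_feasible i); lra.
have var : 0 <= dot (Ll *: (q - b *: p) + grad f y) (- rho *: e - q).
  pose c := u - (2 * delta * T) *: u - T *: grad f y.
  have vcE (a : 'rV_n) : a - c = a - u + (2 * delta * T) *: u + T *: grad f y.
    by rewrite /c !opprB [X in a + X]addrC [_ *: u - u]addrC !addrA.
  have obj :
      velocity_objective f T delta y u = fun a => 1 / 2 * enorm (a - c) ^+ 2.
    by apply/funext => a; rewrite vcE.
  rewrite obj in vmin.
  have wvE : - rho *: e - q = T *: (w - v) by rewrite [RHS]scalerBr wT.
  have LlTT : Ll * T * T = 1 by rewrite -T_Ll; ring.
  have gradE : Ll *: (q - b *: p) + grad f y = (Ll * T) *: (v - c).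
    have qbp : q - b *: p = T *: (v - u + (2 * delta * T) *: u).
      rewrite /q /p [b *: _]scalerA [b * T]mulrC -[X in _ - X]scalerA.
      rewrite -scalerBr; congr (_ *: _).
      rewrite -addrA -scaleNr -[in RHS](scaleN1r u) -scalerDl; congr (_ + _ *: _).
      by rewrite /b -deltaT; ring.
    by rewrite vcE qbp [RHS]scalerDr !scalerA LlTT scale1r.
  rewrite wvE gradE dotZl dotZr mulrA LlTT mul1r.
  apply: (argmin_variational _ _ _ _ vmin) => t /andP[t_gt0 t_lt1] i.
  have /= vi := vD i; have /= wi := wD i.
  rewrite /= [X in _ <= X](_ : _ = (1 - t) * dot (grad (component g i) y) v
    + t * dot (grad (component g i) y) w); last by rewrite !dotE; ring.
  have := ler_wpM2l (ltW t_gt0) wi.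
  have : 0 <= 1 - t by lra.
  by move=> /ler_wpM2l /(_ _ _ vi); lra.
have desc := descent_lemma _ _ y (x + q) l_smooth.
have fx := strongly_convex_above_tangent mu f y x (df y) f_sc.
have fs := strongly_convex_above_tangent mu f y xstar (df y) f_sc.
have quad := momentum_distance_contraction mu s rho b e p
  (ltW mu_gt0) s_ge1 rhoE erefl.
(* Feasibility of v is what turns the g-part of the descent lemma into a
   multiple of lambda g(x). *)
have lin : (1 - rho) * dot lambda (g x) <= dot lambda (g y) +
   \sum_i lambda 0 i * dot (grad (component g i) y) (x + q - y).
  rewrite /dot mulr_sumr -big_split /=; apply: ler_sum => i _.
  rewrite mulrCA -mulrDr ler_wpM2l //.
  exact: (velocity_setP x u v).1 vD i.
have lstar : l xstar = f xstar.
  by rewrite /l /lagrangian /dot big1 ?subr0 // => i _; exact: slack.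
move: desc; rewrite {1}/l dot_grad_lagrangian //; last by move=> i; exact: dg.
have := projection_three_point Ll rho b e p q (grad f y) var.
have xqy : x + q - y = q - b *: p.
  by rewrite yE opprD addrA [_ - x]addrAC subrr add0r.
rewrite xqy; rewrite xqy in lin.
have xy : x - y = - (b *: p) by rewrite yE opprD addrA subrr add0r.
have xsy : xstar - y = - (e + b *: p) by rewrite yE -opprB addrAC.
rewrite xy in fx; rewrite xsy in fs.
rewrite /energy (_ : x + q - xstar + s *: q = e + (1 + s) *: q); last first.
  by rewrite scalerDl scale1r addrA /e [x + q - _]addrAC.
rewrite -/e; move=> three desc; clearbody e p q.
have dist :
    enorm (rho *: e + q) ^+ 2 = rho ^+ 2 * enorm (e + (1 + s) *: q) ^+ 2.
  rewrite -exprMn -enormZ //; congr (enorm _ ^+ 2).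
  rewrite scalerDr scalerA rhoE divfK ?scale1r // gt_eqF //.
  by move: s_ge1; lra.
have lx z : l z = f z - dot lambda (g z) by [].
rewrite -/(l (x + q)) in desc.
rewrite [enorm (e + s *: p) ^+ 2]sqr_enorm.
rewrite dist in three.
rewrite sqr_enorm dotNl !dotNr opprK dotZl !dotZr in fx.
rewrite sqr_enorm dotNl !dotNr opprK in fs.
rewrite [dot _ (_ + _) in X in _ + X + _]dotDr dotZr in fs.
rewrite Ll_mu in three desc *.
have := ler_wpM2l rho_ge0 fs.
have rho1 : 0 <= 1 - rho by rewrite subr_ge0.
have := ler_wpM2l rho1 fx.
rewrite (lx y) in desc; rewrite lstar (lx x).
lra.
Qed.

End Step.

(** * Linear convergence *)

Theorem theorem4 (R : realType) (n ng : nat)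
    (f : 'rV[R]_n -> R) (g : 'rV[R]_n -> 'rV[R]_ng)
    (mu Ll : R) (xstar : 'rV[R]_n) (lambda : 'rV[R]_ng)
    (x u : nat -> 'rV[R]_n) :
  let l := lagrangian f g lambda in
  let kappa := Ll / mu in
  let T := 1 / Num.sqrt Ll in
  let delta := Num.sqrt Ll / (Num.sqrt kappa + 1) in
  let beta := T * (1 - 2 * delta * T) in
  let alpha := delta in
  continuously_differentiable f ->
  coercive f ->
  strongly_convex mu f ->
  (forall i : 'I_ng, smooth (component g i)) ->
  (forall i : 'I_ng, concave (component g i)) ->
  compact (feasible g) ->
  feasible g !=set0 ->
  is_argmin (feasible g) f xstar ->
  optimal_multiplier f g xstar lambda ->
  smooth_with Ll l ->
  u 0%N = 0 ->
  iterates f g T alpha beta delta x u ->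
  forall k : nat,
    mu / 2 * enorm (x k - xstar) ^+ 2 <= l (x k) - l xstar /\
    l (x k) - l xstar <=
      (1 - 1 / (1 + Num.sqrt kappa)) ^+ k
      * (Ll / 8 * enorm (x 0%N - xstar) ^+ 2 + l (x 0%N) - l xstar).
Proof.
move=> l kappa T delta beta alpha [df _] _ f_sc g_smooth g_concave _ _ [xstarF _]
  opt l_smooth u0 iter k.
have dg i : differentiable_everywhere (component g i).
  by have [? []] := g_smooth i.
split; first exact: lagrangian_minimizer_growth.
(* In dimension 0 the constant Ll may be anything, even negative, but both
   sides vanish. *)
have [n0|n_gt0] := posnP n.
  have allE (z : 'rV[R]_n) : z = xstar.
    by apply/rowP => -[i i_lt]; exfalso; move: i_lt; rewrite n0.
  have zero : enorm (xstar - xstar) = 0 by rewrite subrr /enorm dot0l sqrtr0.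
  by rewrite !(allE (x _)) zero expr0n /= mulr0 add0r subrr mulr0.
have [mu_gt0 _] := f_sc.
have mu_le : mu <= Ll.
  exact: (smoothness_ge_strong_convexity f g mu Ll xstar lambda).
have Ll_gt0 : 0 < Ll by exact: lt_le_trans mu_le.
set s := Num.sqrt kappa.
have s_ge1 : 1 <= s.
  have kappa_ge1 : 1 <= kappa by rewrite ler_pdivlMr ?mul1r.
  by rewrite -sqrtr1 ler_sqrt //; lra.
have Ll_mu : Ll = mu * s ^+ 2.
  by rewrite sqr_sqrtr ?divr_ge0 ?ltW // mulrC divfK // gt_eqF.
have sqrtL_gt0 : 0 < Num.sqrt Ll by rewrite sqrtr_gt0.
have T_gt0 : 0 < T by rewrite divr_gt0.
have T_Ll : T ^+ 2 * Ll = 1.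
  rewrite -[Ll in LHS](sqr_sqrtr (ltW Ll_gt0)) -exprMn /T divfK ?expr1n //.
  by rewrite gt_eqF.
set rho := 1 / (1 + s).
have rho_ge0 : 0 <= rho by rewrite divr_ge0 //; lra.
have rho_le_half : rho <= 1 / 2 by rewrite /rho ler_pdivrMr; lra.
have deltaT : delta * T = rho.
  rewrite /delta /T /rho -/s; field.
  by rewrite !gt_eqF //; lra.
have betaE : beta = T * (1 - 2 * rho) by rewrite /beta -mulrA deltaT.
pose E := energy f g Ll xstar lambda s rho.
have contraction j : E (x j) (T *: u j) <= (1 - rho) ^+ j * E (x 0%N) 0.
  elim: j => [|j IH]; first by rewrite u0 scaler0 expr0 mul1r.
  have [umin ->] := iter j.
  apply: le_trans (energy_step f g mu Ll xstar lambda df f_sc dg g_concave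
    xstarF opt l_smooth s T rho delta beta s_ge1 T_gt0 Ll_mu T_Ll erefl deltaT
    betaE _ _ _ umin) _.
  by rewrite exprS -mulrA; apply: ler_wpM2l => //; lra.
apply: le_trans (le_trans _ (contraction k)) _.
  by rewrite lerDl mulr_ge0 ?sqr_ge0 // divr_ge0 // mulr_ge0 ?sqr_ge0 ?ltW.
apply: ler_wpM2l; first by rewrite exprn_ge0 //; lra.
rewrite /E /energy scaler0 addr0 -/l.
have : Ll * rho ^+ 2 / 2 * enorm (x 0%N - xstar) ^+ 2
    <= Ll / 8 * enorm (x 0%N - xstar) ^+ 2.
  apply: ler_wpM2r; first exact: sqr_ge0.
  have : rho ^+ 2 <= 1 / 4 by nra.
  by move=> /(ler_wpM2l (ltW Ll_gt0)); lra.
lra.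
Qed.
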